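(* Let $(Q,\mathfrak{m})$ be a local ring with $\operatorname{depth}G(Q)\ge2$ and let $M$ be a finite $Q$-module with $\operatorname{projdim}_QM\le1$. Then the Hilbert function $n\mapsto\lambda(\mathfrak{m}^nM/\mathfrak{m}^{n+1}M)$ of $M$ is non-decreasing.
   Context: $G(Q)=\bigoplus_{n\ge0}\mathfrak{m}^n/\mathfrak{m}^{n+1}$; its depth is the grade of its irrelevant maximal ideal $\bigoplus_{n\ge1}\mathfrak{m}^n/\mathfrak{m}^{n+1}$. *)

(* Defs.v *)
From HB Require Import structures.
From mathcomp Require Import all_boot all_order all_algebra.
Set Implicit Arguments. Unset Strict Implicit. Unset Printing Implicit Defensive.
Import Order.TTheory GRing.Theory Num.Theory.
Local Open Scope ring_scope.

Section CommAlg.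
Variable Q : comUnitRingType.

Definition ideal (I : Q -> Prop) : Prop :=
  [/\ I 0, (forall x y, I x -> I y -> I (x + y)) & (forall a x, I x -> I (a * x))].

Definition fg_ideal (I : Q -> Prop) : Prop :=
  exists s : seq Q, forall x, I x <->
    exists c : 'I_(size s) -> Q, x = \sum_(i < size s) c i * s`_i.

Definition noetherian : Prop := forall I, ideal I -> fg_ideal I.

Definition local_ring (m : Q -> Prop) : Prop :=
  [/\ noetherian, ideal m, ~ m 1 & forall x, ~ m x -> x \is a GRing.unit].

Inductive prod_ideal (I J : Q -> Prop) : Q -> Prop :=
| prod_ideal0 : prod_ideal I J 0
| prod_idealM a b : I a -> J b -> prod_ideal I J (a * b)
| prod_idealD x y : prod_ideal I J x -> prod_ideal I J y -> prod_ideal I J (x + y).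

Fixpoint ipow (m : Q -> Prop) (n : nat) : Q -> Prop :=
  if n is n'.+1 then prod_ideal m (ipow m n') else (fun _ => True).

Definition submod (M : lmodType Q) (N : M -> Prop) : Prop :=
  [/\ N 0, (forall x y, N x -> N y -> N (x + y)) & (forall a x, N x -> N (a *: x))].

Inductive ideal_smul (M : lmodType Q) (I : Q -> Prop) : M -> Prop :=
| ideal_smul0 : ideal_smul I 0
| ideal_smulZ a v : I a -> ideal_smul I (a *: v)
| ideal_smulD x y : ideal_smul I x -> ideal_smul I y -> ideal_smul I (x + y).

Definition finite_mod (M : lmodType Q) : Prop :=
  exists s : seq M, forall v : M,
    exists c : 'I_(size s) -> Q, v = \sum_(i < size s) c i *: s`_i.

Definition submod_chain (M : lmodType Q) (N1 N2 : M -> Prop) (k : nat) : Prop :=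
  exists C : nat -> M -> Prop,
    [/\ forall v, C 0%N v <-> N1 v,
        forall v, C k v <-> N2 v,
        forall i, submod (C i),
        forall i, (i < k)%N -> forall v, C i v -> C i.+1 v
      & forall i, (i < k)%N -> exists v, C i.+1 v /\ ~ C i v].

Definition quot_length (M : lmodType Q) (N1 N2 : M -> Prop) (l : nat) : Prop :=
  submod_chain N1 N2 l /\ forall k, submod_chain N1 N2 k -> (k <= l)%N.

Definition projective (P : lmodType Q) : Prop :=
  forall (A B : lmodType Q) (g : {linear A -> B}) (f : {linear P -> B}),
    (forall b : B, exists a : A, g a = b) ->
    exists h : {linear P -> A}, forall x, g (h x) = f x.

Definition projdim_le1 (M : lmodType Q) : Prop :=
  exists (P0 P1 : lmodType Q) (i : {linear P1 -> P0}) (p : {linear P0 -> M}),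
    [/\ projective P0, projective P1, injective i,
        (forall v : M, exists x : P0, p x = v)
      & forall x : P0, p x = 0 <-> exists y : P1, x = i y].

(* ---- The associated graded ring G(Q) = (+)_n m^n/m^(n+1) ----
   An element is represented by a family f : nat -> Q of homogeneous
   components, f n in m^n representing a class in m^n/m^(n+1), with only
   finitely many nonzero classes.  Two representatives are equal in G(Q)
   iff all components agree modulo m^(n+1). *)
Definition gr_rep (m : Q -> Prop) (f : nat -> Q) : Prop :=
  (forall n, ipow m n (f n)) /\ exists N, forall n, (N <= n)%N -> ipow m n.+1 (f n).

Definition gr_eq (m : Q -> Prop) (f g : nat -> Q) : Prop :=
  forall n, ipow m n.+1 (f n - g n).

Definition gr_add (f g : nat -> Q) : nat -> Q := fun n => f n + g n.
Definition gr_mul (f g : nat -> Q) : nat -> Q :=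
  fun n => \sum_(i < n.+1) f i * g (n - i)%N.
Definition gr_one : nat -> Q := fun n => if n is 0%N then 1 else 0.
Definition gr_zero : nat -> Q := fun _ => 0.

Definition gr_irrel (m : Q -> Prop) (f : nat -> Q) : Prop := m (f 0%N).

Definition gr_in_ideal (m : Q -> Prop) (xs : seq (nat -> Q)) (h : nat -> Q) : Prop :=
  exists cs : 'I_(size xs) -> (nat -> Q),
    (forall i, gr_rep m (cs i)) /\
    gr_eq m h (\big[gr_add/gr_zero]_(i < size xs) gr_mul (cs i) (nth gr_zero xs i)).

Definition gr_regular_seq (m : Q -> Prop) (xs : seq (nat -> Q)) : Prop :=
  (forall i, (i < size xs)%N -> gr_rep m (nth gr_zero xs i)) /\
  (forall i, (i < size xs)%N -> forall g, gr_rep m g ->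
     gr_in_ideal m (take i xs) (gr_mul (nth gr_zero xs i) g) ->
     gr_in_ideal m (take i xs) g) /\
  ~ gr_in_ideal m xs gr_one.

Definition depth_gr_ge2 (m : Q -> Prop) : Prop :=
  exists x y : nat -> Q,
    [/\ gr_irrel m x, gr_irrel m y & gr_regular_seq m [:: x; y]].

End CommAlg.

(* Main.v *)
Require Import Defs.
From HB Require Import structures.
From mathcomp Require Import all_boot all_order all_algebra.
From mathcomp Require Import perm zify ring.
From Stdlib Require Import Classical IndefiniteDescription.
Set Implicit Arguments. Unset Strict Implicit. Unset Printing Implicit Defensive.
Import GRing.Theory.
Local Open Scope ring_scope.

(** M has a presentation 0 -> Q^r -phi-> Q^s -> M -> 0 with r <= s. Put
    K_n = phi^-1(m^n Q^s) and t_n = length (K_n / m^n Q^r). Additivity of length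
    gives H_M(n) = s H_Q(n) - r H_Q(n) + t_(n+1) - t_n, so it suffices that H_Q is
    non-decreasing and that t is convex.

    Let x_0, ..., x_(d-1) generate m. Depth G(Q) >= 2 is used only through two
    consequences: x_i g in m^(n+1) for all i implies g in m^n, and
    x_j g_i = x_i g_j mod m^(n+1) for all i, j implies g_i = x_i g mod m^n for some g.
    If Q/m is finite there need not be a linear form regular on G(Q), so the
    generic form l = x_0 + x_1 z + ... + x_(d-1) z^(d-1) over Q[z] takes its place:
    McCoy's argument makes multiplication by l injective on coefficient modules,
    and comparing lengths of polynomials of degree < a and < a + d and letting a
    grow yields length E_n <= length E_(n+1) whenever the x_i : E_n -> E_(n+1) have
    no common kernel. This is applied to E_n = m^n/m^(n+1) and to the cokernels of
    l : (K_n/m^n)[z] -> (K_(n+1)/m^(n+1))[z], of length (a + d) t_(n+1) - a t_n in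
    degrees < a + d, where a grows once more. *)

(** * Length of subquotients *)

Lemma sum_delta (R : pzRingType) n (F : 'I_n -> R) i :
  \sum_j (j == i)%:R * F j = F i.
Proof.
rewrite (bigD1 i) //= eqxx mul1r big1 ?addr0 // => j /negbTE ->.
by rewrite mul0r.
Qed.

Section Submodules.
Variable Q : comUnitRingType.

Definition sub (M : lmodType Q) (A B : M -> Prop) := forall v, A v -> B v.

Definition sumsub (M W : lmodType Q) (A : W -> Prop) (f : M -> W) (B : M -> Prop)
  (w : W) := exists a b, [/\ A a, B b & w = a + f b].

Lemma submodN (M : lmodType Q) (A : M -> Prop) v : submod A -> A v -> A (- v).
Proof. by case=> _ _ h /(h (-1)); rewrite scaleN1r. Qed.

Lemma submodB (M : lmodType Q) (A : M -> Prop) v w :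
  submod A -> A v -> A w -> A (v - w).
Proof. by move=> sA Av /(submodN sA); case: sA => _ h _; apply: h. Qed.

Lemma submodBl (M : lmodType Q) (A : M -> Prop) v w :
  submod A -> A (v + w) -> A v -> A w.
Proof. by move=> sA Avw /(submodB sA Avw); rewrite addrC addKr. Qed.

Lemma submod_sum (M : lmodType Q) (A : M -> Prop) (I : finType) (P : pred I)
    (F : I -> M) :
  submod A -> (forall i, P i -> A (F i)) -> A (\sum_(i | P i) F i).
Proof. by case=> A0 AD _ h; elim/big_ind: _ => //. Qed.

Lemma submod_lin (M W : lmodType Q) (A : M -> Prop) (f : {linear M -> W})
  (B : W -> Prop) : submod A -> submod B -> submod (fun v => A v /\ B (f v)).
Proof.
case=> A0 AD AZ [B0 BD BZ]; split; rewrite ?linear0 //.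
- by move=> v w [? ?] [? ?]; rewrite linearD; split; [apply: AD|apply: BD].
- by move=> a v [? ?]; rewrite linearZ; split; [apply: AZ|apply: BZ].
Qed.

Lemma submod_sumsub (M W : lmodType Q) (A : W -> Prop) (f : {linear M -> W})
  (B : M -> Prop) : submod A -> submod B -> submod (sumsub A f B).
Proof.
case=> A0 AD AZ [B0 BD BZ]; split.
- by exists 0, 0; rewrite linear0 addr0.
- move=> _ _ [a [b [Aa Bb ->]]] [a' [b' [Aa' Bb' ->]]].
  by exists (a + a'), (b + b'); rewrite linearD addrACA; split; auto.
- move=> c _ [a [b [Aa Bb ->]]]; exists (c *: a), (c *: b).
  by rewrite linearZ scalerDr; split; auto.
Qed.

Lemma sub_suml (M W : lmodType Q) (A : W -> Prop) (f : {linear M -> W})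
  (B : M -> Prop) : submod B -> sub A (sumsub A f B).
Proof. by case=> B0 _ _ a Aa; exists a, 0; rewrite linear0 addr0. Qed.

Lemma sub_sumr (M W : lmodType Q) (A : W -> Prop) (f : {linear M -> W})
  (B : M -> Prop) b : submod A -> B b -> sumsub A f B (f b).
Proof. by case=> A0 _ _ Bb; exists 0, b; rewrite add0r. Qed.

(* Strict chains of submodules between A and B that need not start at A; this
   changes neither the maximal length nor the existence of one. *)
Fixpoint chain (M : lmodType Q) (A : M -> Prop) (k : nat) (B : M -> Prop) : Prop :=
  if k is k'.+1 then
    exists X, [/\ submod X, sub X B, exists2 v, B v & ~ X v & chain A k' X]
  else sub A B.

Definition len (M : lmodType Q) (A B : M -> Prop) (l : nat) :=
  chain A l B /\ forall k, chain A k B -> (k <= l)%N.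

Lemma chain_sub (M : lmodType Q) (A B : M -> Prop) k : chain A k B -> sub A B.
Proof.
elim: k B => //= k IH B [X [_ XB _ /IH AX]] v /AX; exact: XB.
Qed.

Lemma chain_mono (M : lmodType Q) (A B C : M -> Prop) k :
  sub B C -> chain A k B -> chain A k C.
Proof.
case: k => [|k] BC /=; first by move=> AB v /AB /BC.
case=> X [sX XB [v Bv nXv] c]; exists X; split=> //; first by move=> w /XB /BC.
by exists v => //; apply: BC.
Qed.

Lemma chain_cat (M : lmodType Q) (A B C : M -> Prop) k l :
  chain A k B -> chain B l C -> chain A (l + k) C.
Proof.
move=> cAB; elim: l C => [|l IH] C /=; first by move=> BC; apply: chain_mono cAB.
by case=> X [sX XC sXC /IH cX]; exists X.
Qed.

(* Modular law: a strict inclusion X < C stays strict after meeting with B or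
   after adding B. *)
Lemma chain_split (M : lmodType Q) (A B C : M -> Prop) k :
  submod B -> submod C -> sub A B -> chain A k C ->
  exists k1 k2, [/\ (k <= k1 + k2)%N, chain A k1 (fun v => B v /\ C v)
    & chain B k2 (sumsub B idfun C)].
Proof.
move=> sB + AB; elim: k C => [|k IH] C sC /=.
  move=> AC; exists 0%N, 0%N; split=> //=; first by move=> v Av; split; auto.
  exact: (@sub_suml _ _ _ idfun).
case=> X [sX XC [v Cv nXv] /(IH X sX)[k1 [k2 [le_k c1 c2]]]].
have sBX : submod (sumsub B idfun X) by exact: (@submod_sumsub _ _ _ idfun).
have sIX := @submod_lin _ _ _ idfun _ sB sX.
have [[w Cw nw]|h] := classic (exists2 w, sumsub B idfun C w & ~ sumsub B idfun X w).
  exists k1, k2.+1; rewrite addnS ltnS; split=> //.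
    by apply: chain_mono c1 => u [Bu /XC].
  exists (sumsub B idfun X); split=> //; last by exists w.
  by move=> _ [b [x [Bb Xx ->]]]; exists b, x; split=> //; apply: XC.
exists k1.+1, k2; rewrite addSn ltnS; split=> //; last first.
  apply: chain_mono c2 => _ [b [x [Bb Xx ->]]]; exists b, x; split=> //; exact: XC.
exists (fun v => B v /\ X v); split=> //; first by move=> u [Bu /XC].
have [b [x [Bb Xx ev]]] : sumsub B idfun X v.
  by apply: NNPP => nv; apply: h; exists v => //; apply: (@sub_sumr _ _ _ idfun).
exists b; last first.
  by case=> _ Xb; apply: nXv; rewrite ev; case: sX => _ XD _; apply: XD.
split=> //; have -> : b = v - x by rewrite ev addrK.
by apply: submodB => //; apply: XC.
Qed.

Lemma len_bounded (M : lmodType Q) (A B : M -> Prop) n :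
  sub A B -> (forall k, chain A k B -> (k <= n)%N) -> exists l, len A B l.
Proof.
move=> AB; elim: n => [|n IH] h; first by exists 0%N.
have [c|nc] := classic (chain A n.+1 B); first by exists n.+1.
apply: IH => k ck; have := h k ck.
by rewrite leq_eqVlt => /orP[/eqP ek|//]; rewrite ek in ck.
Qed.

Lemma len_unique (M : lmodType Q) (A B : M -> Prop) k l :
  len A B k -> len A B l -> k = l.
Proof. by move=> [c1 h1] [c2 h2]; apply/eqP; rewrite eqn_leq h1 ?h2. Qed.

Lemma len_ext (M : lmodType Q) (A B C : M -> Prop) l :
  (forall v, B v <-> C v) -> len A B l -> len A C l.
Proof.
move=> e [c h]; split; first by apply: chain_mono c => v /e.
by move=> k ck; apply: h; apply: chain_mono ck => v /e.
Qed.

Lemma len_add (M : lmodType Q) (A B C : M -> Prop) k l :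
  submod B -> submod C -> len A B k -> len B C l -> len A C (k + l).
Proof.
move=> sB sC [cAB hAB] [cBC hBC]; split; first by rewrite addnC; apply: chain_cat cBC.
move=> n /(chain_split sB sC (chain_sub cAB))[k1 [k2 [le_n c1 c2]]].
apply: leq_trans le_n _; apply: leq_add.
  by apply: hAB; apply: chain_mono c1 => v [].
apply: hBC; apply: chain_mono c2 => _ [b [x [Bb Cx ->]]].
by case: sC => _ CD _; apply: CD => //; apply: (chain_sub cBC).
Qed.

Lemma len_sub (M : lmodType Q) (A B C : M -> Prop) n :
  submod B -> submod C -> sub A B -> sub B C -> len A C n ->
  exists k l, [/\ len A B k, len B C l & (k + l)%N = n].
Proof.
move=> sB sC AB BC lAC; have [_ h] := lAC.
have [k lAB] : exists k, len A B k.
  by apply: (@len_bounded _ _ _ n) => // k ck; apply/h/(chain_mono BC).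
have [l lBC] : exists l, len B C l.
  apply: (@len_bounded _ _ _ n) => // l cl; apply: leq_trans (leq_addr 0 _) _.
  by apply/h; apply: chain_cat cl.
exists k, l; split=> //; exact: len_unique (len_add sB sC lAB lBC) lAC.
Qed.

(** A member X becomes A' + f(X). If f(v) fell into it, then v - x, for some x in X, would lie in B
    with image in A', hence in A and in X. *)
Lemma chain_image (M W : lmodType Q) (f : {linear M -> W}) (A B C : M -> Prop)
    (A' : W -> Prop) k :
  submod A' -> submod C -> sub C B -> (forall v, B v -> A' (f v) -> A v) ->
  chain A k C -> chain A' k (sumsub A' f C).
Proof.
move=> sA'; elim: k C => [|k IH] C sC CB h /=; first by move=> _; apply: sub_suml.
case=> X [sX XC [v Cv nXv] cX]; exists (sumsub A' f X); split.
- exact: submod_sumsub.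
- by move=> _ [a [x [A'a Xx ->]]]; exists a, x; split=> //; apply: XC.
- exists (f v); first exact: sub_sumr.
  case=> a [x [A'a Xx e]]; apply: nXv; rewrite -(subrK x v).
  case: (sX) => _ XD _; apply: XD => //; apply: (chain_sub cX); apply: h.
    apply: CB; apply: submodB => //; exact: XC.
  by rewrite linearB e addrK.
- by apply: IH => // w /XC /CB.
Qed.

(** Strictness survives because every element of C is congruent modulo A' to the image of an element
    of B. *)
Lemma chain_preimage (M W : lmodType Q) (f : {linear M -> W}) (A B : M -> Prop)
    (A' C : W -> Prop) k :
  submod B -> submod C -> sub C (sumsub A' f B) -> sub A B ->
  (forall v, A v -> A' (f v)) ->
  chain A' k C -> chain A k (fun v => B v /\ C (f v)).
Proof.
move=> sB + + AB h; elim: k C => [|k IH] C sC CB /=.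
  by move=> A'C v Av; split; [apply: AB|apply/A'C/h].
case=> X [sX XC [v Cv nXv] cX]; exists (fun v => B v /\ X (f v)); split.
- exact: submod_lin.
- by move=> w [Bw /XC].
- have [a [b [A'a Bb ev]]] := CB v Cv.
  have Xa : X a by apply: (chain_sub cX).
  exists b; last by case=> _ Xb; apply: nXv; rewrite ev; case: sX => _ XD _; apply: XD.
  split=> //; have -> : f b = v - a by rewrite ev addrC addKr.
  by apply: submodB => //; apply: XC.
- by apply: IH => // w /XC /CB.
Qed.

Lemma len_le (M W : lmodType Q) (f : {linear M -> W}) (A B : M -> Prop)
    (A' B' : W -> Prop) k l :
  submod B -> submod A' -> submod B' -> sub A' B' ->
  (forall v, B v -> B' (f v)) -> (forall v, B v -> A' (f v) -> A v) ->
  len A B k -> len A' B' l -> (k <= l)%N.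
Proof.
move=> sB sA' [_ B'D _] A'B' fB h [c _] [_ h']; apply: h'.
have := chain_image sA' sB (fun v => id) h c; apply: chain_mono.
by move=> _ [a [b [/A'B' A'a /fB Bb ->]]]; apply: B'D.
Qed.

(** The map induces an isomorphism from B/A onto (A' + f(B))/A', so chains are carried over in both
    directions. *)
Lemma len_iso (M W : lmodType Q) (f : {linear M -> W}) (A B : M -> Prop)
    (A' : W -> Prop) l :
  submod B -> submod A' -> sub A B -> (forall v, B v -> (A' (f v) <-> A v)) ->
  len A B l <-> len A' (sumsub A' f B) l.
Proof.
move=> sB sA' AB h.
have h1 k : chain A k B -> chain A' k (sumsub A' f B).
  by apply: chain_image (fun v => id) _ => // v Bv /h; apply.
have h2 k : chain A' k (sumsub A' f B) -> chain A k B.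
  move=> c; have := @chain_preimage _ _ f A B A' (sumsub A' f B) k sB _ _ AB _ c.
  move=> c'; apply: (@chain_mono _ _ (fun v => B v /\ sumsub A' f B (f v))); last apply: c'.
  - by move=> v [].
  - exact: submod_sumsub.
  - by [].
  - by move=> v Av; apply/h => //; apply: AB.
by split=> -[c hc]; (split; first by auto) => k /ltac:(auto).
Qed.

(** A [chain] may begin above A, whereas [submod_chain] starts at A exactly, so the lowest member is
    replaced by A. *)
Lemma quot_length_len (M : lmodType Q) (A B : M -> Prop) l :
  submod A -> submod B -> len A B l -> quot_length A B l.
Proof.
move=> sA sB [c h]; split; last first.
  move=> k [C [C0 Ck sC Cle Clt]]; apply: h.
  have : forall i, (i <= k)%N -> chain A i (C i).
    elim=> [|i IH] ik /=; first by move=> v /C0.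
    exists (C i); split=> //; [exact: Cle| |exact/IH/ltnW].
    by have [v []] := Clt i ik; exists v.
  by move/(_ k (leqnn k)); apply: chain_mono => v /Ck.
(* Length 0 leaves no member to replace; there maximality forces A = B. *)
case: l c h => [|l] c h.
  exists (fun _ => A); split=> // v; split; first exact: (chain_sub c).
  move=> Bv; apply: NNPP => nAv; suff: (1 <= 0)%N by [].
  by apply: h; exists A; split=> //; exists v.
have {h} ch : forall k X, submod X -> chain A k X -> (A = X \/ (0 < k)%N) -> submod_chain A X k.
  elim=> [|k IH] X sX /=; first by move=> _ [<-|//]; exists (fun _ => A).
  case=> Y [sY YX [v Xv nYv] cY] _.
  case: (posnP k) cY => [-> AY|k0 cY].
    exists (fun i => if i is 0%N then A else X); split=> //; try by case.
      by case=> [] //= _ w /AY /YX.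
    by case=> [] //= _; exists v; split=> // /AY.
  have [] := IH Y sY cY; first by right.
  move=> C [C0 Ck sC Cle Clt]; exists (fun i => if (i <= k)%N then C i else X); split=> //.
  - by move=> w; rewrite ltnn.
  - by move=> i; case: ifP.
  - move=> i ik w; have -> : (i <= k)%N by lia.
    case: ifP => [ik'|nik]; first exact: Cle.
    have e : i = k by lia.
    by rewrite e => /Ck /YX.
  - move=> i ik; have -> : (i <= k)%N by lia.
    case: ifP => [ik'|nik]; first exact: Clt.
    have e : i = k by lia.
    by exists v; split=> //; rewrite e => /Ck.
by apply: ch => //; right.
Qed.
End Submodules.

(** * Multiplication by the generic linear form *)

Section Multiplication.
Variables (Q : comUnitRingType) (V : lmodType Q).

Definition powmod N (A : V -> Prop) (v : {ffun 'I_N -> V}) := forall i, A (v i).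

Lemma submod_pow N (A : V -> Prop) : submod A -> submod (powmod (N := N) A).
Proof.
case=> A0 AD AZ; split=> [i|v w Av Aw i|a v Av i]; rewrite ffunE //.
- exact: AD.
- exact: AZ.
Qed.

Definition inj_at N (k : 'I_N) (v : V) : {ffun 'I_N -> V} :=
  [ffun j => if j == k then v else 0].

Lemma inj_at_is_linear N k : linear (@inj_at N k).
Proof.
by move=> a v w; apply/ffunP=> j; rewrite !ffunE; case: ifP; rewrite ?scaler0 ?addr0.
Qed.
HB.instance Definition _ N (k : 'I_N) :=
  GRing.isLinear.Build Q V {ffun 'I_N -> V} _ (@inj_at N k) (inj_at_is_linear k).

(** In the filtration by [D k] the first k coordinates range over B and the others over A; each step
    is a copy of B/A placed by [inj_at]. *)
Lemma len_pow N (A B : V -> Prop) l : submod A -> submod B ->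
  len A B l -> len (powmod (N := N) A) (powmod B) (N * l).
Proof.
move=> sA sB lAB; have [cAB _] := lAB; have AB := chain_sub cAB.
pose D k (v : {ffun 'I_N -> V}) := forall i : 'I_N, if (i < k)%N then B (v i) else A (v i).
have sD k : submod (D k).
  case: (sA) (sB) => A0 AD AZ [B0 BD BZ]; split=> [i|v w Dv Dw i|a v Dv i]; rewrite ffunE.
  - by case: ifP.
  - by move: (Dv i) (Dw i); case: ifP => _; auto.
  - by move: (Dv i); case: ifP => _; auto.
have D0 : forall v, D 0%N v <-> powmod A v by [].
have DN : forall v, D N v <-> powmod B v.
  by move=> v; split=> h i; move: (h i); rewrite ltn_ord.
suff h : forall k, (k <= N)%N -> len (powmod A) (D k) (k * l).
  by apply: len_ext DN _; apply: h.
elim=> [|k IH] kN.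
  by split=> [v /D0 //|n]; case: n => // n [X [_ XD [v /D0 Av nXv] c]]; case: nXv; apply: (chain_sub c).
rewrite mulSn addnC; apply: len_add (IH (ltnW kN)) _ => //.
pose k' := Ordinal kN.
apply: (@len_ext _ _ _ (sumsub (D k) (inj_at k') B)); last first.
  apply/(len_iso (A := A)) => // v Bv; split=> [/(_ k')|Av i]; rewrite ffunE ?eqxx ?ltnn //.
  case: (sA) (sB) => A0 _ _ [B0 _ _].
  by case: eqP => [->|_]; rewrite ?ltnn //; case: ifP.
move=> v; split=> [[a [b [Da Bb ->]]] i|Dv].
  case: (sA) (sB) => A0 AD _ [B0 BD _]; rewrite !ffunE; move: (Da i).
  case: eqP => [-> _|ne]; last first.
    rewrite addr0; have -> : (i < k.+1)%N = (i < k)%N; last by [].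
    by rewrite ltnS leq_eqVlt; case: eqP => // e; case: ne; apply/val_inj.
  rewrite leqnn; apply: BD => //; apply: AB; have := Da k'; by rewrite ltnn.
exists (v - inj_at k' (v k')), (v k'); split; rewrite ?subrK //.
  move=> i; rewrite !ffunE; case: eqP => [->|ne].
    by rewrite ltnn subrr; case: sA.
  move: (Dv i); rewrite subr0; have -> // : (i < k.+1)%N = (i < k)%N.
  by rewrite ltnS leq_eqVlt; case: eqP => // e; case: ne; apply/val_inj.
by have := Dv k'; rewrite leqnn.
Qed.

Variables (d : nat) (x : 'I_d -> Q).

(* Multiplication by [x_0 + x_1 z + ... + x_(d-1) z^(d-1)] on sequences of
   coefficients in V. *)
Definition conv (w : nat -> V) (k : nat) : V :=
  \sum_(i < d | (i <= k)%N) x i *: w (k - i)%N.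

Definition ext a (v : {ffun 'I_a -> V}) (k : nat) : V := oapp v 0 (insub k).

Lemma ext_ord a (v : {ffun 'I_a -> V}) (i : 'I_a) : ext v i = v i.
Proof. by rewrite /ext valK. Qed.

Lemma ext_out a (v : {ffun 'I_a -> V}) k : (a <= k)%N -> ext v k = 0.
Proof. by move=> h; rewrite /ext insubF // ltnNge h. Qed.

Lemma ext_linear a c (v w : {ffun 'I_a -> V}) k :
  ext (c *: v + w) k = c *: ext v k + ext w k.
Proof.
by rewrite /ext; case: insubP => [i _ _|_] /=; rewrite ?ffunE // scaler0 addr0.
Qed.

Lemma ext_in a (A : V -> Prop) (v : {ffun 'I_a -> V}) k :
  submod A -> powmod A v -> A (ext v k).
Proof. by move=> [A0 _ _] Av; rewrite /ext; case: insubP => [i _ _|_] /=. Qed.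

(** A polynomial of degree < a times the form of degree < d fits into a + d coefficients, also for a
    = 0 or d = 0. *)
Definition convmod a (v : {ffun 'I_a -> V}) : {ffun 'I_(a + d) -> V} :=
  [ffun j => conv (ext v) (val j)].

Lemma convmod_is_linear a : linear (@convmod a).
Proof.
move=> c v w; apply/ffunP=> j; rewrite !ffunE /conv scaler_sumr -big_split /=.
apply: eq_bigr => i _; rewrite ext_linear scalerDr; congr (_ + _).
by rewrite !scalerA mulrC.
Qed.
HB.instance Definition _ a := GRing.isLinear.Build Q {ffun 'I_a -> V}
  {ffun 'I_(a + d) -> V} _ (@convmod a) (@convmod_is_linear a).

Lemma conv_ext_out a (v : {ffun 'I_a -> V}) k : (a + d <= k)%N -> conv (ext v) k = 0.
Proof.
move=> h; rewrite /conv big1 // => i _; rewrite ext_out ?scaler0 //.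
have := ltn_ord i; lia.
Qed.

Lemma conv_convmod (A : V -> Prop) a (v : {ffun 'I_a -> V}) k :
  submod A -> powmod A (convmod v) -> A (conv (ext v) k).
Proof.
move=> [A0 _ _] h; have [k_lt|/conv_ext_out-> //] := ltnP k (a + d).
by have := h (Ordinal k_lt); rewrite ffunE.
Qed.

Lemma conv_in (A : V -> Prop) (w : nat -> V) k : submod A ->
  (forall i j, A (x i *: w j)) -> A (conv w k).
Proof. by move=> sA h; apply: submod_sum => // i _. Qed.

Lemma conv_scale c (w : nat -> V) k : conv (fun j => c *: w j) k = c *: conv w k.
Proof.
by rewrite /conv scaler_sumr; apply: eq_bigr => i _; rewrite !scalerA mulrC.
Qed.

(** * Filtrations whose graded pieces B_n/A_n have no common kernel of the x_i *)

Section Filtration.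
Variables (A B : nat -> V -> Prop).
Hypotheses (sA : forall n, submod (A n)) (sB : forall n, submod (B n)).
Hypotheses (xA : forall n i v, A n v -> A n.+1 (x i *: v)).
Hypotheses (xB : forall n i v, B n v -> B n.+1 (x i *: v)).
Hypothesis colon : forall n v, B n v -> (forall i, A n.+1 (x i *: v)) -> A n v.

(* McCoy: induction on the degree e of w modulo A. By descending induction on i,
   the polynomial x_i w has lower degree, because the coefficient of z^(e + i) in
   the product is x_i w_e up to terms already known to vanish. *)
Lemma mccoy n w e : (forall j, B n (w j)) -> (forall j, (e <= j)%N -> A n (w j)) ->
  (forall k, A n.+1 (conv w k)) -> forall j, A n (w j).
Proof.
elim: e n w => [|e IH] n w Bw Aw Acw j; first exact: Aw.
apply: colon => // i; move: j; have [p] := ubnP (d - i).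
elim: p i => // p IHp i ip j.
apply: (IH n.+1 (fun j => x i *: w j)) => {j} [j|j ej|k]; [exact: xB| |by rewrite conv_scale; apply: xA].
move: ej; rewrite leq_eqVlt => /orP[/eqP <-|ej]; last by apply/xA/Aw.
have := Acw (e + i)%N; rewrite /conv (bigD1 i) ?leq_addl //= addnK addrC.
move/submodBl; apply => //; apply: submod_sum => // i' /andP[i'e ii'].
(* Larger i' fall under the descending induction; smaller i' meet a coefficient w_j with j > e. *)
have [lt|ge] := ltnP i i'; first by apply: IHp; have := ltn_ord i'; lia.
by apply/xA/Aw; move: ii'; rewrite -val_eqE /=; lia.
Qed.

Lemma mccoy_convmod n a (v : {ffun 'I_a -> V}) :
  powmod (B n) v -> powmod (A n.+1) (convmod v) -> powmod (A n) v.
Proof.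
move=> Bv h i; rewrite -ext_ord; apply: (mccoy (e := a)) => [j|j aj|k].
- exact: ext_in.
- by rewrite ext_out //; case: (sA n).
- exact: conv_convmod.
Qed.

Lemma powmod_convmod (C D : V -> Prop) a (v : {ffun 'I_a -> V}) : submod C -> submod D ->
  (forall i v, C v -> D (x i *: v)) -> powmod C v -> powmod D (convmod v).
Proof.
by move=> sC sD h Cv j; rewrite ffunE; apply: conv_in => // i k; apply: h; apply: ext_in.
Qed.

(** By McCoy the generic form embeds polynomials of degree < a over B_n/A_n into those of degree < a
    + d over B_(n+1)/A_(n+1). *)
Lemma len_le_succ n k l : (forall n, sub (A n) (B n)) ->
  len (A n) (B n) k -> len (A n.+1) (B n.+1) l -> (k <= l)%N.
Proof.
move=> AB lk ll.
have h a : (a * k <= (a + d) * l)%N.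
  apply: (len_le (f := @convmod a) _ _ _ _ _ _
    (@len_pow a _ _ _ (sA n) (sB n) lk) (@len_pow (a + d) _ _ _ (sA n.+1) (sB n.+1) ll)).
  - exact: submod_pow.
  - exact: submod_pow.
  - exact: submod_pow.
  - by move=> v Av i; apply: AB.
  - by move=> v; apply: powmod_convmod => //; apply: xB.
  - by move=> v; apply: mccoy_convmod.
(* If k > l, then [h] would give a <= d * l, which fails for this a. *)
by have := h (d * l).+1; nia.
Qed.
End Filtration.
End Multiplication.

(** * Free modules *)

Section FreeModules.
Variable Q : comUnitRingType.
Local Notation free r := {ffun 'I_r -> Q^o}.

Definition lincomb (W : lmodType Q) r (g : 'I_r -> W) (u : free r) : W :=
  \sum_i u i *: g i.

Lemma lincomb_is_linear (W : lmodType Q) r (g : 'I_r -> W) : linear (lincomb g).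
Proof.
move=> a u v; rewrite /lincomb scaler_sumr -big_split; apply: eq_bigr => i _.
by rewrite !ffunE scalerDl scalerA.
Qed.
HB.instance Definition _ (W : lmodType Q) r (g : 'I_r -> W) :=
  GRing.isLinear.Build Q (free r) W _ (lincomb g) (lincomb_is_linear g).

Lemma free_sum r (v : free r) : v = \sum_i v i *: inj_at i (1 : Q^o).
Proof.
apply/ffunP=> j; rewrite sum_ffunE (bigD1 j) //= big1 => [|i ij].
  by rewrite !ffunE eqxx addr0 [_ *: _]mulr1.
by rewrite !ffunE eq_sym (negbTE ij) scaler0.
Qed.

Lemma free_linear (W : lmodType Q) r (f : {linear free r -> W}) u :
  f u = lincomb (fun i => f (inj_at i (1 : Q^o))) u.
Proof.
by rewrite {1}(free_sum u) linear_sum; apply: eq_bigr => i _; rewrite linearZ.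
Qed.

Lemma free_lift (W U : lmodType Q) r (h : {linear free r -> U}) (q : {linear W -> U}) :
  (forall u, exists w, q w = h u) ->
  exists h' : {linear free r -> W}, forall u, q (h' u) = h u.
Proof.
move=> /(_ (inj_at _ (1 : Q^o))) lift.
have [g hg] := functional_choice _ lift.
exists (lincomb g) => u; rewrite [RHS]free_linear /lincomb linear_sum.
by apply: eq_bigr => i _; rewrite linearZ hg.
Qed.

Lemma rank_le_of_injective r s (f : {linear free r -> free s}) : injective f -> (r <= s)%N.
Proof.
move=> injf; case: leqP => //; case: r f injf => // r f injf lt_sr.
(* Since s is less than the size of the matrix, [ext] pads each row of s entries with zeros to a
   square matrix. *)
pose A : 'M[Q]_r.+1 := \matrix_(i, j)
  ext (f (inj_at i (1 : Q^o))) j.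
have Alast k : A k ord_max = 0 by rewrite mxE ext_out.
have injA (u : 'rV_r.+1) : u *m A = 0 -> u = 0.
  move=> uA0; pose v : free r.+1 := [ffun i => u 0 i].
  suff v0 : v = 0 by apply/rowP=> i; rewrite mxE; move/ffunP/(_ i): v0; rewrite !ffunE.
  apply: injf; rewrite linear0 free_linear; apply/ffunP=> j.
  have jr : (j < r.+1)%N by apply: ltn_trans (ltn_ord j) lt_sr.
  move/rowP/(_ (Ordinal jr)): uA0; rewrite !mxE => uA0.
  rewrite /lincomb sum_ffunE [RHS]ffunE -[RHS]uA0.
  by apply: eq_bigr => i _; rewrite !mxE !ffunE ext_ord.
(* The last column of A vanishes, so a polynomial annihilating A has no constant
   term, and A can be cancelled; Cayley-Hamilton gives a contradiction. *)
have hA p : horner_mx A p = 0 -> p = 0.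
  elim/poly_ind: p => // p c IH; rewrite rmorphD rmorphM /= horner_mx_X horner_mx_C => e.
  have c0 : c = 0.
    move/matrixP/(_ ord_max ord_max): e; rewrite !mxE eqxx mulr1n big1 ?add0r // => k _.
    by rewrite Alast mulr0.
  rewrite c0 raddf0 addr0 in e *; rewrite IH ?mul0r ?add0r //.
  apply/row_matrixP=> i; rewrite row0; apply: injA.
  by rewrite -row_mul -[_ *m _]/(_ * _) e row0.
by have := char_poly_monic A; rewrite (hA _ (Cayley_Hamilton A)) monicE lead_coef0 eq_sym oner_eq0.
Qed.

Definition generates (W : lmodType Q) (N : W -> Prop) k (g : 'I_k -> W) :=
  (forall i, N (g i)) /\ forall w, N w -> exists c, w = lincomb g c.

(** Induction on the number t of coordinates allowed to be nonzero: the values of the last one form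
    a finitely generated ideal. Lifts of its generators, with generators of the part where it
    vanishes, generate N. *)
Lemma noetherian_free r (N : free r -> Prop) : noetherian Q -> submod N ->
  exists k (g : 'I_k -> free r), generates N g.
Proof.
move=> noeth; suff h t : (t <= r)%N -> forall N : free r -> Prop, submod N ->
    (forall w (i : 'I_r), N w -> (t <= i)%N -> w i = 0) ->
    exists k (g : 'I_k -> free r), generates N g.
  by move=> sN; apply: (h r) => // w i _; rewrite leqNgt ltn_ord.
elim: t => [|t IH] tr {}N sN hN.
  exists 0%N, (fun=> 0); split=> [[]//|w Nw]; exists 0.
  by rewrite linear0; apply/ffunP=> i; rewrite hN // ffunE.
have [N0 ND NZ] := sN; pose t' := Ordinal tr.
have [] := noeth (fun a => exists2 w, N w & w t' = a).
  split=> [|_ _ [v Nv <-] [w Nw <-]|a _ [w Nw <-]].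
  - by exists 0; rewrite ?ffunE.
  - by exists (v + w); rewrite ?ffunE //; apply: ND.
  - by exists (a *: w); rewrite ?ffunE //; apply: NZ.
move=> s hs.
have [g hg] : exists g : 'I_(size s) -> free r, forall i, N (g i) /\ g i t' = s`_i.
  apply: (functional_choice (fun (i : 'I_(size s)) (w : free r) => N w /\ w t' = s`_i)) => i.
  suff [w] : exists2 w, N w & w t' = s`_i by exists w.
  apply/hs; exists (fun j => (j == i)%:R).
  by rewrite sum_delta.
have [||k [g' [Ng' hg']]] := IH (ltnW tr) (fun w => N w /\ w t' = 0).
- split=> [|v w [Nv v0] [Nw w0]|a w [Nw w0]]; rewrite ?ffunE //.
  + by rewrite v0 w0 addr0; split=> //; apply: ND.
  + by rewrite w0 scaler0; split=> //; apply: NZ.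
- move=> w i [Nw w0]; rewrite leq_eqVlt => /orP[/eqP ti|]; last exact: hN.
  by have -> : i = t' by apply: val_inj.
exists (size s + k)%N, (fun i => match split i with inl j => g j | inr j => g' j end).
split=> [i|w Nw].
  by case: split => j; [case: (hg j)|case: (Ng' j)].
have [c hc] : exists c : 'I_(size s) -> Q, w t' = \sum_i c i * s`_i.
  by apply/hs; exists w.
have [|c' hc'] := hg' (w - \sum_i c i *: g i).
  split.
    apply: (submodB sN) => //; apply: (submod_sum sN) => i _; apply: NZ.
    by case: (hg i).
  rewrite !ffunE sum_ffunE hc; apply/eqP; rewrite subr_eq0; apply/eqP/eq_bigr => i _.
  by rewrite ffunE (hg i).2.
exists [ffun i => match split i with inl j => c j | inr j => c' j end].
rewrite /lincomb big_split_ord /= -[LHS](subrK (\sum_i c i *: g i)) addrC hc'.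
congr (_ + _); apply: eq_bigr => i _; rewrite ffunE.
  by rewrite -[rshift _ i]/(unsplit (inr i)) unsplitK.
by rewrite -[lshift k i]/(unsplit (inl i)) unsplitK.
Qed.

Section Kernel.
Variables (U V : lmodType Q) (f : {linear U -> V}).

Definition in_ker : {pred U} := [pred w | f w == 0].

Lemma in_ker_closed : submod_closed in_ker.
Proof.
split=> [|a u v]; rewrite !inE ?linear0 // => /eqP fu /eqP fv.
by rewrite linearP fu fv scaler0 addr0.
Qed.
HB.instance Definition _ := GRing.isSubmodClosed.Build Q U in_ker in_ker_closed.

(** [projective] speaks of surjections between modules, so the kernel has to be a module type of its
    own. *)
Record kernel := Kernel { kernel_val :> U; kernelP : kernel_val \in in_ker }.
HB.instance Definition _ := [isSub for kernel_val].
HB.instance Definition _ := [Choice of kernel by <:].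
HB.instance Definition _ := [SubChoice_isSubLmodule of kernel by <:].

Section Corestriction.
Variables (W : lmodType Q) (h : {linear W -> U}) (fh0 : forall w, h w \in in_ker).
Definition to_kernel w := Kernel (fh0 w).
Lemma to_kernel_is_linear : linear to_kernel.
Proof. by move=> a u v; apply: val_inj; rewrite /= linearP. Qed.
HB.instance Definition _ :=
  GRing.isLinear.Build Q W kernel _ to_kernel to_kernel_is_linear.
End Corestriction.

(** Corestricted to the kernel of [f], the map [q] becomes surjective and projectivity applies. *)
Lemma projective_lift_kernel (P W : lmodType Q) (h : {linear P -> U}) (q : {linear W -> U}) :
  projective P -> (forall u, f (h u) = 0) -> (forall w, f (q w) = 0) ->
  (forall v, f v = 0 -> exists w, q w = v) ->
  exists h' : {linear P -> W}, forall u, q (h' u) = h u.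
Proof.
move=> projP fh fq qs.
have fh' u : h u \in in_ker by rewrite inE fh.
have fq' w : q w \in in_ker by rewrite inE fq.
have [|h' hh'] := projP _ _ (to_kernel fq' : {linear W -> kernel}) (to_kernel fh').
  move=> [v hv]; have [|w qw] := qs v; first by apply/eqP; rewrite -[_ == _]/(v \in in_ker).
  by exists w; apply: val_inj.
by exists h' => u; have /(congr1 kernel_val) := hh' u.
Qed.
End Kernel.

End FreeModules.

(** * Powers of the maximal ideal *)

Section LocalRing.
Variables (Q : comUnitRingType) (m : Q -> Prop).
Hypothesis loc : local_ring m.

Lemma ideal_max : ideal m. Proof. by case: loc. Qed.

Lemma ideal_ipow n : ideal (ipow m n).
Proof.
case: n => [|n] //=; case: ideal_max => _ _ mM.
split=> [|y z|a y]; [exact: prod_ideal0|exact: prod_idealD|].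
elim=> [|b c mb Ic|y' z' _ IHy _ IHz]; first by rewrite mulr0; apply: prod_ideal0.
  by rewrite mulrA; apply: prod_idealM => //; apply: mM.
by rewrite mulrDr; apply: prod_idealD.
Qed.

Lemma submod_ipow n : submod (ipow m n : Q^o -> Prop).
Proof. exact: (ideal_ipow n). Qed.

Lemma ipowS_sub n y : ipow m n.+1 y -> ipow m n y.
Proof.
have [I0 ID IM] := ideal_ipow n.
by elim=> // [a b _ /IM|a b _ Ia _ Ib]; [apply|apply: ID].
Qed.

Lemma ipow_mulS n a b : m a -> ipow m n b -> ipow m n.+1 (a * b).
Proof. exact: prod_idealM. Qed.

Lemma ipow_mul i j a b : ipow m i a -> ipow m j b -> ipow m (i + j) (a * b).
Proof.
move=> + Jb; elim: i a => [|i IH] a /=.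
  by move=> _; have [_ _] := ideal_ipow j; apply.
elim=> [|u v mu Iv|u v _ Iu _ Iv].
- by rewrite mul0r; apply: prod_ideal0.
- by rewrite -mulrA; apply: prod_idealM => //; apply: IH.
- by rewrite mulrDl; apply: prod_idealD.
Qed.

(** Modulo A the vector spans a cyclic module killed by m. A submodule strictly above A contains c'
    v modulo A for some c' outside m, that is a unit, and so contains v. *)
Lemma len_add_vector (M : lmodType Q) (A : M -> Prop) v : submod A ->
  (forall a, m a -> A (a *: v)) ->
  exists l, len A (fun w => exists c : Q, A (w - c *: v)) l.
Proof.
move=> sA; case: (sA) => A0 AD AZ hv; apply: (@len_bounded _ _ _ _ 1).
  by move=> w Aw; exists 0; rewrite scale0r subr0.
case=> [|[|k]] //= [X [sX sXB [w [c Aw] nXw] [Y [sY YX [y Xy nYy] /chain_sub AY]]]].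
case: nXw; have AX z : A z -> X z by move=> /AY /YX.
suff Xv : X v.
  rewrite -(subrK (c *: v) w); case: sX => _ XD XZ; apply: XD; [exact: AX|exact: XZ].
have [c' Ay] := sXB y Xy.
have uc' : c' \is a GRing.unit.
  case: loc => _ _ _; apply=> mc'; apply: nYy; apply: AY.
  by rewrite -(subrK (c' *: v) y); apply: AD => //; apply: hv.
have -> : v = c'^-1 *: (y - (y - c' *: v)).
  by rewrite opprB addrC subrK scalerA mulVr // scale1r.
by case: (sX) => _ _ XZ; apply/XZ/(submodB sX) => //; apply: AX.
Qed.

(** B/A is finitely generated and killed by m; the generators are added one at a time. *)
Lemma len_fg (M : lmodType Q) (A B : M -> Prop) n (g : 'I_n -> M) : submod A ->
  (forall a i, m a -> A (a *: g i)) ->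
  (forall v, B v <-> exists c : 'I_n -> Q, A (v - \sum_i c i *: g i)) ->
  exists l, len A B l.
Proof.
move=> sA hg hB.
pose C k (v : M) := exists c : 'I_n -> Q, A (v - \sum_(i < n | (i < k)%N) c i *: g i).
suff [l lC] : exists l, len A (C n) l.
  exists l; apply: len_ext lC => v; rewrite hB.
  have e (c : 'I_n -> Q) :
      \sum_(i < n | (i < n)%N) c i *: g i = \sum_(i < n) c i *: g i.
    by apply: eq_bigl => i; rewrite ltn_ord.
  by split=> -[c h]; exists c; rewrite e in h *.
have [A0 AD AZ] := sA.
have sC k : submod (C k).
  split=> [|v w [c hv] [c' hw]|a v [c hv]].
  - by exists (fun=> 0); rewrite big1 ?subr0 // => i _; rewrite scale0r.
  - exists (fun i => c i + c' i); under eq_bigr do rewrite scalerDl.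
    by rewrite big_split opprD addrACA; apply: AD.
  - exists (fun i => a * c i); under eq_bigr do rewrite -scalerA.
    by rewrite -scaler_sumr -scalerBr; apply: AZ.
(* Induction on the number k of generators used, while the index type stays ['I_n]. *)
have : (n <= n)%N := leqnn n; move: {1 3}n; elim=> [|k IH] kn.
  exists 0%N; split=> [v Av|].
    by exists (fun=> 0); rewrite big_pred0 ?subr0.
  case=> // p [X [_ XC [v [c]]]]; rewrite big_pred0 ?subr0 // => Av nXv /chain_sub AX.
  by case: nXv; apply: AX.
have [l lk] := IH (ltnW kn); pose k' := Ordinal kn.
have AC k0 v : A v -> C k0 v.
  by move=> Av; exists (fun=> 0); rewrite big1 ?subr0 // => i _; rewrite scale0r.
have sumS (c : 'I_n -> Q) : \sum_(i < n | (i < k.+1)%N) c i *: g i =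
    \sum_(i < n | (i < k)%N) c i *: g i + c k' *: g k'.
  rewrite (bigD1 k') ?leqnn //= addrC; congr (_ + _).
  by apply: eq_bigl => i; rewrite ltnS [RHS]ltn_neqAle andbC -val_eqE.
have [l' lk'] : exists l, len (C k) (fun w => exists c, C k (w - c *: g k')) l.
  by apply: len_add_vector => // a ma; apply/AC/hg.
exists (l + l')%N; apply: len_add lk _ => //; apply: len_ext lk' => v; split.
  move=> [a [c h]]; exists (fun i => if i == k' then a else c i).
  rewrite sumS eqxx opprD addrA addrAC; rewrite (eq_bigr (fun i => c i *: g i)) //.
  by move=> i; case: eqP => // ->; rewrite ltnn.
by move=> [c]; rewrite sumS opprD addrA addrAC => h; exists (c k'), c.
Qed.

Lemma ipow0r n : ipow m n 0. Proof. by case: (ideal_ipow n). Qed.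

Lemma ipowD n a b : ipow m n a -> ipow m n b -> ipow m n (a + b).
Proof. by case: (ideal_ipow n) => _ h _; apply: h. Qed.

Lemma ipowZ n a b : ipow m n b -> ipow m n (a * b).
Proof. by case: (ideal_ipow n) => _ _ h; apply: h. Qed.

Lemma ipowB n a b : ipow m n a -> ipow m n b -> ipow m n (a - b).
Proof. exact: (submodB (submod_ipow n)). Qed.

Lemma ipow_sum n (I : finType) (P : pred I) (F : I -> Q) :
  (forall i, P i -> ipow m n (F i)) -> ipow m n (\sum_(i | P i) F i).
Proof. exact: (submod_sum (submod_ipow n)). Qed.

(** * Products and degree shifts of representatives in G(Q) *)

Definition shift n (f : nat -> Q) (k : nat) : Q := if (n <= k)%N then f (k - n)%N else 0.

Lemma shift1S f k : shift 1 f k.+1 = f k.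
Proof. by rewrite /shift subn1. Qed.

Lemma gr_mulC (f g : nat -> Q) k : gr_mul f g k = gr_mul g f k.
Proof.
rewrite /gr_mul (reindex_inj rev_ord_inj) /=; apply: eq_bigr => i _.
by rewrite subSS mulrC subKn // -ltnS.
Qed.

Lemma gr_mul_shift n (f g : nat -> Q) k : gr_mul f (shift n g) k = shift n (gr_mul f g) k.
Proof.
rewrite /gr_mul {2}/shift; case: leqP => nk; last first.
  by rewrite big1 // => i _; rewrite /shift ifN ?mulr0 //; lia.
have -> : k.+1 = ((k - n).+1 + n)%N by lia.
rewrite big_split_ord /= [X in _ + X]big1 ?addr0 => [|i _]; last first.
  by have := ltn_ord i; rewrite /shift /= => ik; rewrite ifN ?mulr0 //; lia.
apply: eq_bigr => i _; have := ltn_ord i => ik.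
by rewrite /shift ifT; [congr (_ * g _); lia|lia].
Qed.

(** Isolates the degree 0 component, which lies in m for elements of the irrelevant ideal and so
    contributes nothing to products in G(Q). *)
Lemma gr_mul_tail (f g : nat -> Q) k :
  gr_mul f g k = f 0%N * g k + shift 1 (gr_mul (fun i => f i.+1) g) k.
Proof.
rewrite /gr_mul big_ord_recl subn0 /shift; congr (_ + _).
case: k => [|k]; first by rewrite big_ord0.
by rewrite /= subn1; apply: eq_bigr => i _; rewrite /bump /= add1n subSS.
Qed.

Lemma gr_mul_const (f : nat -> Q) a k :
  gr_mul f (fun i => if i is 0%N then a else 0) k = f k * a.
Proof.
rewrite /gr_mul big_ord_recr /= subnn big1 ?add0r // => i _.
by rewrite -(subnSK (ltn_ord i)) mulr0.
Qed.

Lemma ipow_shift n r f k : (forall i, ipow m (i + n + r) (f i)) ->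
  ipow m (k + r) (shift n f k).
Proof.
move=> h; rewrite /shift; case: ifP => [nk|_]; last exact: ipow0r.
by have := h (k - n)%N; rewrite subnK.
Qed.

Lemma ipow_shift0 n f k : (forall i, ipow m (i + n) (f i)) -> ipow m k (shift n f k).
Proof. by move=> h; rewrite -{1}[k]addn0; apply: ipow_shift => i; rewrite addn0. Qed.

(** * Consequences of depth G(Q) >= 2 for the powers of m *)

Section Depth.
Variables (d : nat) (x : 'I_d -> Q).
Hypothesis gen : forall y, m y <-> exists c : 'I_d -> Q, y = \sum_i c i * x i.

Lemma max_gen i : m (x i).
Proof.
apply/gen; exists (fun j => (j == i)%:R).
by rewrite sum_delta.
Qed.

Lemma ipow_gen n a : ipow m n.+1 a ->
  exists2 c : 'I_d -> Q, forall i, ipow m n (c i) & a = \sum_i c i * x i.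
Proof.
elim=> [|b c /gen[e ->] Ic|b c _ [e Ie ->] _ [e' Ie' ->]].
- exists (fun=> 0) => [i|]; first exact: ipow0r.
  by rewrite big1 // => i _; rewrite mul0r.
- exists (fun i => e i * c) => [i|]; first exact: ipowZ.
  by rewrite mulr_suml; apply: eq_bigr => i _; rewrite mulrAC.
- exists (fun i => e i + e' i) => [i|]; first exact: ipowD.
  by rewrite -big_split; apply: eq_bigr => i _; rewrite mulrDl.
Qed.

(* The third clause keeps finitely many nonzero classes in G(Q). *)
Definition coeffs (X : nat -> Q) (a : nat -> 'I_d -> Q) :=
  forall k, [/\ X k.+1 = \sum_i a k i * x i, forall i, ipow m k (a k i)
    & ipow m k.+2 (X k.+1) -> forall i, ipow m k.+1 (a k i)].

Lemma coeffs_exist X : (forall k, ipow m k (X k)) -> exists a, coeffs X a.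
Proof.
move=> hX; apply: (functional_choice (fun k (a : 'I_d -> Q) => [/\ X k.+1 = \sum_i a i * x i,
  forall i, ipow m k (a i) & ipow m k.+2 (X k.+1) -> forall i, ipow m k.+1 (a i)])) => k.
have [/ipow_gen[c Ic e]|n] := classic (ipow m k.+2 (X k.+1)).
  by exists c; split=> // i; apply: ipowS_sub.
by have [c Ic e] := ipow_gen (hX k.+1); exists c.
Qed.

Variables X Y : nat -> Q.
Hypotheses (X0 : m (X 0%N)) (Y0 : m (Y 0%N)) (regXY : gr_regular_seq m [:: X; Y]).

Lemma gr_rep_X : gr_rep m X. Proof. by case: regXY => /(_ 0%N isT). Qed.
Lemma gr_rep_Y : gr_rep m Y. Proof. by case: regXY => /(_ 1%N isT). Qed.

Lemma regX g : gr_rep m g -> (forall n, ipow m n.+1 (gr_mul X g n)) ->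
  forall n, ipow m n.+1 (g n).
Proof.
move=> rg h; have [_ [/(_ 0%N isT g rg) /= reg _]] := regXY.
case: reg => [|cs [_ e] n].
  exists (fun=> @gr_zero Q); split; first by case.
  by move=> n; rewrite big_ord0 subr0.
by have := e n; rewrite big_ord0 subr0.
Qed.

Lemma regY g c : gr_rep m g -> gr_rep m c ->
  (forall n, ipow m n.+1 (gr_mul Y g n - gr_mul X c n)) ->
  exists2 c', gr_rep m c' & forall n, ipow m n.+1 (g n - gr_mul X c' n).
Proof.
move=> rg rc h; have [_ [/(_ 1%N isT g rg) /= reg _]] := regXY.
case: reg => [|cs [rcs e]].
  exists (fun=> c); split=> // n; rewrite /= big_ord_recl big_ord0 /= /gr_add addr0.
  by rewrite [gr_mul c X n]gr_mulC; apply: h.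
exists (cs ord0) => // n.
by have := e n; rewrite /= big_ord_recl big_ord0 /= /gr_add addr0 gr_mulC.
Qed.

(** Components of X in positive degree are combinations of the x_i, and X_0 lies in m, so what all
    x_i kill in G(Q) is killed by X. *)
Lemma irrel_mul a n g : coeffs X a -> ipow m n g ->
  (forall i, ipow m n.+2 (x i * g)) -> forall k, ipow m (k + n).+1 (X k * g).
Proof.
move=> hX Ig h [|k]; first exact: ipow_mulS.
have [-> Ia _] := hX k; rewrite mulr_suml; apply: ipow_sum => i _.
by rewrite -mulrA addSn -!addnS; apply: ipow_mul.
Qed.

Lemma gr_rep_const n g : ipow m n g ->
  gr_rep m (shift n (fun i => if i is 0%N then g else 0)).
Proof.
move=> Ig; split=> [k|].
  by apply: ipow_shift0 => -[|i] //; apply: ipow0r.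
exists n.+1 => k nk; rewrite /shift ifT; last lia.
by case E : (k - n)%N => [|p]; [lia|apply: ipow0r].
Qed.

(** The class of g in degree n is killed by all x_i, hence by X, which is regular. *)
Lemma colon_homogeneous n g : ipow m n g -> (forall i, ipow m n.+2 (x i * g)) ->
  ipow m n.+1 g.
Proof.
move=> Ig h; have [a hX] := coeffs_exist gr_rep_X.1.
have := regX (gr_rep_const Ig) _ n; rewrite {2}/shift leqnn subnn; apply=> k.
rewrite gr_mul_shift -addn1; apply: ipow_shift => i.
by rewrite gr_mul_const addn1; apply: (irrel_mul hX).
Qed.

(** Powers are gained one at a time: induction puts g in m^n, and the homogeneous case raises this
    to m^(n+1). *)
Lemma ipow_colon n g : (forall i, ipow m n.+1 (x i * g)) -> ipow m n g.
Proof.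
elim: n g => // n IH g h; apply: colon_homogeneous => //; apply: IH => i.
exact: ipowS_sub.
Qed.

(* Write X = sum a_i x_i and Y = sum b_i x_i up to degree 0. Then u = sum a_i g_i and
   v = sum b_i g_i satisfy Y u = X v in G(Q), so u = X c by regularity, and
   X g_j = x_j u = X x_j c gives g_j = x_j c. *)
Lemma koszul_homogeneous n (g : 'I_d -> Q) : (forall i, ipow m n (g i)) ->
  (forall i j, ipow m n.+2 (x j * g i - x i * g j)) ->
  exists c, forall i, ipow m n.+1 (g i - x i * c).
Proof.
move=> Ig h; have [a hX] := coeffs_exist gr_rep_X.1; have [b hY] := coeffs_exist gr_rep_Y.1.
(* The coefficients [a k] of X_(k+1) have degree k, so [U a k] is the component of u in degree k +
   n. *)
pose U (a : nat -> 'I_d -> Q) k := \sum_i a k i * g i.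
have rU Z e : gr_rep m Z -> coeffs Z e -> gr_rep m (shift n (U e)).
  move=> [IZ [N hN]] he; split=> [k|].
    apply: ipow_shift0 => i; by apply: ipow_sum => j _; apply: ipow_mul => //; case: (he i).
  exists (N + n)%N => k hk; rewrite /shift ifT; last lia.
  have -> : (k.+1 = (k - n).+1 + n)%N by lia.
  apply: ipow_sum => j _; apply: ipow_mul => //; case: (he (k - n)%N) => _ _; apply.
  by apply: hN; lia.
have rX := rU _ _ gr_rep_X hX; have rY := rU _ _ gr_rep_Y hY.
case: (regY rX rY) => [k|c rc hc].
  rewrite !gr_mul_tail opprD addrACA; apply: ipowD.
    by apply: ipowB; apply: ipow_mulS => //; [apply: rX.1|apply: rY.1].
  have -> : forall f f' : nat -> Q, shift 1 f k - shift 1 f' k = shift 1 (fun i => f i - f' i) k.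
    by move=> f f'; rewrite /shift; case: ifP => _; rewrite ?subrr.
  rewrite -addn1; apply: ipow_shift => {}k; rewrite !gr_mul_shift.
  rewrite /shift; case: leqP => nk; last by rewrite subrr; apply: ipow0r.
  rewrite [X in _ - X]gr_mulC /gr_mul -sumrB; apply: ipow_sum => i _.
  have /[!ltnS] ik := ltn_ord i.
  have [-> Ib _] := hY i; have [-> Ia _] := hX (k - n - i)%N.
  rewrite /U !mulr_suml -sumrB; apply: ipow_sum => j _.
  rewrite !mulr_sumr -sumrB; apply: ipow_sum => l _.
  have -> : b i j * x j * (a (k - n - i)%N l * g l) - b i j * g j * (a (k - n - i)%N l * x l)
    = (b i j * a (k - n - i)%N l) * (x j * g l - x l * g j) by ring.
  have -> : (k + 1 + 1 = (i + (k - n - i)) + n.+2)%N by lia.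
  by apply: ipow_mul => //; apply: ipow_mul.
(* As x_j has degree 1, the equation g_j = x_j c in degree n involves c_(n-1), read as 0 for n =
   0. *)
exists (shift 1 c n) => j.
(* [w] represents g_j - x_j c; regularity of X leaves X w = 0 in G(Q) to be shown. *)
pose w k := shift n (fun i => if i is 0%N then g j else 0) k - x j * shift 1 c k.
have rw : gr_rep m w.
  have [Id [N hN]] := gr_rep_const (Ig j); have [Ic [N' hN']] := rc.
  have mc : m (x j) := max_gen j.
  split=> [k|].
    apply: ipowB => //; case: k => [|k] //.
    by rewrite shift1S; apply: ipow_mulS.
  exists (N + N'.+1)%N => k hk; apply: ipowB; first by apply: hN; lia.
  case: k hk => [|k] hk; first lia.
  by rewrite shift1S; apply: ipow_mulS => //; apply: hN'; lia.
have := regX rw _ n; rewrite /w {3}/shift leqnn subnn; apply=> k.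
have -> : gr_mul X w k = shift n (fun i => X i * g j) k - x j * shift 1 (gr_mul X c) k.
  rewrite -gr_mul_shift /w /gr_mul mulr_sumr.
  have -> : shift n (fun i => X i * g j) k =
      gr_mul X (shift n (fun i => if i is 0%N then g j else 0)) k.
    by rewrite gr_mul_shift /shift; case: ifP; rewrite ?gr_mul_const.
  by rewrite /gr_mul -sumrB; apply: eq_bigr => i _; ring.
case: k => [|k].
  rewrite {2}/shift mulr0 subr0 /shift; case: ifP => _; last exact: ipow0r.
  by rewrite sub0n; apply: ipow_mulS.
rewrite shift1S.
(* X c is replaced by u, up to an error controlled by [hc]. *)
rewrite -[gr_mul X c k](subKr (shift n (U a) k)) mulrBr opprB addrCA; apply: ipowD.
  by apply: ipow_mulS; [exact: max_gen|exact: hc].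
(* In degrees above n the Koszul relations apply, below n both terms are zero, and in degree n only
   X_0 g_j remains, with X_0 in m. *)
rewrite /shift; case: (ltngtP n k.+1) => [nk|nk|nk].
- rewrite ifT; last lia.
  have -> : (k.+1 - n = (k - n).+1)%N by lia.
  have [-> Ia _] := hX (k - n)%N; rewrite /U mulr_suml mulr_sumr -sumrB.
  apply: ipow_sum => i _.
  have -> : a (k - n)%N i * x i * g j - x j * (a (k - n)%N i * g i)
    = a (k - n)%N i * (x i * g j - x j * g i) by ring.
  have -> : (k.+2 = (k - n) + n.+2)%N by lia.
  exact: ipow_mul.
- by rewrite ifN ?mulr0 ?subrr; [apply: ipow0r|lia].
rewrite ifN ?mulr0 ?subr0; last lia.
by rewrite -nk subnn; apply: ipow_mulS.
Qed.

(** Successive approximation: if c is a solution modulo m^n, the errors g_i - x_i c satisfy the same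
    relations, and the homogeneous case corrects c. *)
Lemma ipow_koszul n (g : 'I_d -> Q) :
  (forall i j, ipow m n.+1 (x j * g i - x i * g j)) ->
  exists c, forall i, ipow m n (g i - x i * c).
Proof.
elim: n g => [|n IH] g h; first by exists 0.
have [c hc] : exists c, forall i, ipow m n (g i - x i * c).
  by apply: IH => i j; apply: ipowS_sub.
have [i j|c' hc'] := koszul_homogeneous hc.
  by have -> : x j * (g i - x i * c) - x i * (g j - x j * c) = x j * g i - x i * g j by ring.
by exists (c + c') => i; rewrite mulrDr opprD addrA.
Qed.
End Depth.

(** * Lengths attached to a free presentation of M *)

Section Presentation.
Variables (d : nat) (x : 'I_d -> Q).
Hypothesis gen : forall y, m y <-> exists c : 'I_d -> Q, y = \sum_i c i * x i.
Hypothesis colon : forall n g, (forall i, ipow m n.+1 (x i * g)) -> ipow m n g.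
Hypothesis koszul : forall n (g : 'I_d -> Q),
  (forall i j, ipow m n.+1 (x j * g i - x i * g j)) ->
  exists c, forall i, ipow m n (g i - x i * c).

Lemma len_gr n : exists l, len (ipow m n.+1 : Q^o -> Prop) (ipow m n : Q^o -> Prop) l.
Proof.
have [noeth _ _ _] := loc.
have [s hs] := noeth _ (ideal_ipow n).
apply: (@len_fg Q^o (ipow m n.+1) (ipow m n) (size s) (fun i => s`_i)) => [|a i ma|v].
- exact: submod_ipow.
- apply: ipow_mulS => //; apply/hs; exists (fun j => (j == i)%:R).
  by rewrite sum_delta.
split=> [/hs[c ->]|[c h]].
  by exists c; rewrite subrr; apply: ipow0r.
rewrite -(subrK (\sum_i c i *: (s`_i : Q^o)) v); apply: ipowD; first exact: ipowS_sub.
by apply/hs; exists c.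
Qed.

Lemma len_gr_mono n k l :
  len (ipow m n.+1 : Q^o -> Prop) (ipow m n : Q^o -> Prop) k ->
  len (ipow m n.+2 : Q^o -> Prop) (ipow m n.+1 : Q^o -> Prop) l -> (k <= l)%N.
Proof.
apply: (@len_le_succ Q Q^o d x (fun n => ipow m n.+1) (fun n => ipow m n)).
- by move=> p; apply: submod_ipow.
- by move=> p; apply: submod_ipow.
- by move=> p i v; apply: ipow_mulS; apply: max_gen gen _.
- by move=> p i v; apply: ipow_mulS; apply: max_gen gen _.
- by move=> p v _; apply: colon.
- by move=> p v; apply: ipowS_sub.
Qed.

Local Notation free r := {ffun 'I_r -> Q^o}.

Definition freepow r n : free r -> Prop := powmod (ipow m n : Q^o -> Prop).

Lemma submod_freepow r n : submod (@freepow r n).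
Proof. exact/submod_pow/submod_ipow. Qed.

Lemma freepowS_sub r n : sub (@freepow r n.+1) (@freepow r n).
Proof. by move=> v h i; apply: ipowS_sub. Qed.

Lemma freepow0 r v : @freepow r 0 v. Proof. by []. Qed.

Lemma freepow_mulS r n i v : @freepow r n v -> @freepow r n.+1 (x i *: v).
Proof. by move=> h j; rewrite ffunE; apply: ipow_mulS => //; apply: max_gen gen _. Qed.

Lemma freepow_colon r n v : (forall i, @freepow r n.+1 (x i *: v)) -> @freepow r n v.
Proof. by move=> h j; apply: colon => i; have := h i j; rewrite ffunE. Qed.

Lemma freepow_linear r s (f : {linear free r -> free s}) n v :
  freepow n v -> freepow n (f v).
Proof.
move=> h; rewrite free_linear; apply: submod_sum => [|i _].
  exact: submod_freepow.
by move=> j; rewrite ffunE [_ *: _]mulrC; apply: ipowZ; apply: h.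
Qed.

Variables (M : lmodType Q) (r s : nat).
Variables (phi : {linear free r -> free s}) (pi : {linear free s -> M}).
Hypothesis pi_surj : forall v, exists w, pi w = v.
Hypothesis pi_ker : forall w, pi w = 0 <-> exists u, w = phi u.
Hypothesis le_rs : (r <= s)%N.

(** The submodule K_n; its quotient by m^n Q^r has length t_n. *)
Definition fpow n (u : free r) := freepow n (phi u).

Lemma submod_fpow n : submod (fpow n).
Proof.
have := submod_lin phi (submod_freepow r 0) (submod_freepow s n).
case=> [[_ f0] fD fZ]; split=> // [u v hu hv|a u hu].
  by case: (fD u v).
by case: (fZ a u).
Qed.

Lemma fpowS_sub n : sub (fpow n.+1) (fpow n).
Proof. by move=> u; apply: freepowS_sub. Qed.

Lemma freepow_fpow n : sub (@freepow r n) (fpow n).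
Proof. by move=> u; apply: freepow_linear. Qed.

Lemma len_ipow n : exists l, len (ipow m n : Q^o -> Prop) (ipow m 0 : Q^o -> Prop) l.
Proof.
elim: n => [|n [l lk]].
  exists 0%N; split=> // k; case: k => // k [X [_ _ [v _ nXv] /chain_sub h]].
  by case: nXv; apply: h.
have [l' lk'] := len_gr n; exists (l' + l)%N.
by apply: len_add lk' lk; apply: submod_ipow.
Qed.

(** K_n/m^n Q^r sits inside Q^r/m^n Q^r, which has finite length. *)
Lemma len_fpow n : exists l, len (@freepow r n) (fpow n) l.
Proof.
have [l h] := len_ipow n.
have := @len_pow _ _ r _ _ _ (submod_ipow n) (submod_ipow 0) h.
move/len_sub => /(_ (fpow n)) []; last by move=> k [_ [hk _ _]]; exists k.
- exact: submod_fpow.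
- exact: submod_freepow.
- exact: freepow_fpow.
- by move=> v _; apply: freepow0.
Qed.

Lemma ideal_smulP n v : ideal_smul (ipow m n) v <-> exists2 w, freepow n w & v = pi w.
Proof.
split.
  elim=> [|a u Ia|u v' _ [w hw ->] _ [w' hw' ->]].
  - by exists 0; rewrite ?linear0 //; case: (submod_freepow s n).
  - have [w <-] := pi_surj u; exists (a *: w); last by rewrite linearZ.
    by move=> j; rewrite ffunE [_ *: _]mulrC; apply: ipowZ.
  - exists (w + w'); last by rewrite linearD.
    by case: (submod_freepow s n) => _ h _; apply: h.
move=> [w hw ->]; rewrite free_linear /lincomb.
elim/big_ind: _ => [|u v' hu hv|i _]; first exact: ideal_smul0.
  exact: ideal_smulD.
by apply: ideal_smulZ; apply: hw.
Qed.

Lemma submod_ideal_smul n : submod (ideal_smul (ipow m n) : M -> Prop).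
Proof.
split=> [|u v|a v /ideal_smulP[w hw ->]]; [exact: ideal_smul0|exact: ideal_smulD|].
rewrite -linearZ; apply/ideal_smulP; exists (a *: w) => //.
by case: (submod_freepow s n) => _ _; apply.
Qed.

(** Between m^(n+1) Q^s and m^n Q^s lies m^(n+1) Q^s + phi(K_n). The lower quotient is K_n/K_(n+1)
    by [phi], the upper one m^n M/m^(n+1) M by [pi]. *)
Lemma len_hilbert n q h : len (ipow m n.+1 : Q^o -> Prop) (ipow m n : Q^o -> Prop) q ->
  len (fpow n.+1) (fpow n) h ->
  exists2 l, len (ideal_smul (ipow m n.+1) : M -> Prop) (ideal_smul (ipow m n)) l
    & (h + l = s * q)%N.
Proof.
move=> lq lh; have sA := submod_freepow s n.+1; have sB := submod_freepow s n.
have := @len_pow _ _ s _ _ _ (submod_ipow n.+1) (submod_ipow n) lq.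
move/len_sub => /(_ (sumsub (freepow n.+1) phi (fpow n))) [].
- by apply: submod_sumsub => //; apply: submod_fpow.
- exact: sB.
- by apply: sub_suml; apply: submod_fpow.
- move=> _ [a [b [/freepowS_sub ha hb ->]]].
  by case: sB => _ BD _; apply: BD.
move=> k [l [lk ll <-]].
have ek : h = k.
  apply: len_unique lk; have sK := submod_fpow n.
  exact: (proj1 (len_iso h sK sA (@fpowS_sub n) (fun _ _ => iff_refl _)) lh).
exists l; last by rewrite ek.
apply: (@len_ext _ _ _ (sumsub (ideal_smul (ipow m n.+1)) pi (@freepow s n))) => [v|].
  split=> [[a [b [/ideal_smulP[w hw ->] hb ->]]]|/ideal_smulP[w hw ->]].
    by rewrite -linearD; apply/ideal_smulP; exists (w + b) => //; case: sB => _ BD _;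
       apply: BD => //; apply: freepowS_sub.
  by exists 0, w; rewrite add0r; split=> //; apply: ideal_smul0.
refine (proj1 (len_iso (f := pi) l sB (submod_ideal_smul n.+1) _ _) ll).
  move=> _ [a [b [/freepowS_sub ha hb ->]]].
  by case: sB => _ BD _; apply: BD.
move=> w hw; split=> [/ideal_smulP[w' hw' e]|[a [b [ha hb ->]]]].
  have [u hu] : exists u, w - w' = phi u by apply/pi_ker; rewrite linearB e subrr.
  exists w', u; split=> //; last by rewrite -hu addrC subrK.
  by rewrite /fpow -hu; apply: (submodB sB) => //; apply: freepowS_sub.
apply/ideal_smulP; exists a => //; rewrite linearD.
have -> : pi (phi b) = 0 by apply/pi_ker; exists b.
by rewrite addr0.
Qed.

(** Write x_i v = mu_i + l f_i. Cancelling l by McCoy gives x_j f_i = x_i f_j modulo m^(n+2), so f_i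
    = x_i g modulo m^(n+1) by [koszul]. Then [colon] puts v - l g in m^(n+1) and g in K_n. *)
Lemma conv_colon a n (v : {ffun 'I_(a + d) -> free r}) :
  (forall i, sumsub (powmod (freepow n.+2)) (@convmod _ _ d x a) (powmod (N := a) (fpow n.+1))
     (x i *: v)) ->
  sumsub (powmod (freepow n.+1)) (@convmod _ _ d x a) (powmod (N := a) (fpow n)) v.
Proof.
set L := @convmod Q (free r) d x a => h.
have LB u w : L (u - w) = L u - L w by rewrite /L linearB.
have LZ b u : L (b *: u) = b *: L u by rewrite /L linearZ.
have sF k := submod_freepow r k; have sK := submod_fpow.
have sFp N k := @submod_pow _ _ N _ (sF k).
have [f hf] := functional_choice (fun i f => exists2 mu : {ffun 'I_(a + d) -> free r},
  powmod (freepow n.+2) mu & powmod (N := a) (fpow n.+1) f /\ x i *: v = mu + L f)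
  (fun i => let: ex_intro mu (ex_intro f (And3 hmu hf e)) := h i in
     ex_intro _ f (ex_intro2 _ _ mu hmu (conj hf e))).
have LF k (u : {ffun 'I_a -> free r}) :
    powmod (freepow k) u -> powmod (freepow k.+1) (L u).
  by apply: powmod_convmod => // i w; apply: freepow_mulS.
have comm i j : powmod (freepow n.+2) (x j *: f i - x i *: f j).
  apply: (mccoy_convmod (x := x) (A := @freepow r) (B := fun _ _ => True)) => //.
  - by move=> p k w; apply: freepow_mulS.
  - by move=> p w _; apply: freepow_colon.
  change (powmod (freepow n.+3) (L (x j *: f i - x i *: f j))); rewrite LB !LZ.
  have [mu hmu [_ e]] := hf i; have [mu' hmu' [_ e']] := hf j.
  have -> : x j *: L (f i) - x i *: L (f j) = x i *: mu' - x j *: mu.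
    have -> : L (f i) = x i *: v - mu by rewrite e addrC addKr.
    have -> : L (f j) = x j *: v - mu' by rewrite e' addrC addKr.
    by rewrite !scalerBr !scalerA [x j * x i]mulrC addrAC opprB addrCA subrr addr0.
  by apply: (submodB (sFp _ _)) => k; rewrite ffunE; apply: freepow_mulS.
(* [koszul] is applied separately to each coordinate of each coefficient. *)
have [c hc] := functional_choice
  (fun (pq : 'I_a * 'I_r) c => forall i, ipow m n.+1 (f i pq.1 pq.2 - x i * c))
  (fun pq => koszul (g := fun i => f i pq.1 pq.2) (n := n.+1) (fun i j =>
     eq_ind _ _ (comm i j pq.1 pq.2) _ ltac:(by rewrite !ffunE))).
pose g : {ffun 'I_a -> free r} := [ffun p => [ffun q => c (p, q)]].
have fg i : powmod (freepow n.+1) (f i - x i *: g).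
  by move=> p q; rewrite !ffunE; apply: (hc (p, q)).
exists (v - L g), g; split; last by rewrite subrK.
  move=> p; apply: freepow_colon => i.
  have [mu hmu [_ e]] := hf i.
  have -> : x i *: (v - L g) p = (mu + L (f i - x i *: g)) p.
    by rewrite LB LZ addrA -e -scalerBr [RHS]ffunE.
  by rewrite ffunE; case: (sF n.+2) => _ + _; apply; [apply: hmu|apply: LF].
(* Here x_i phi(g) = phi(f_i) modulo m^(n+1), and f_i lies in K_(n+1). *)
move=> p; apply: freepow_colon => i; rewrite -linearZ.
have [_ _ [/(_ p) hfi _]] := hf i.
have -> : x i *: g p = f i p - (f i - x i *: g) p by rewrite !ffunE opprB addrC subrK.
rewrite linearB; apply: (submodB (submod_freepow s n.+1)) => //.
by apply: freepow_linear; apply: fg.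
Qed.

(** [len_le_succ] is applied to modules that already consist of coefficient vectors, so a second
    polynomial variable enters; [conv_colon] excludes a common kernel. *)
Lemma len_fpow_convex n t0 t1 t2 : len (freepow n) (fpow n) t0 ->
  len (freepow n.+1) (fpow n.+1) t1 -> len (freepow n.+2) (fpow n.+2) t2 ->
  (t1 + t1 <= t0 + t2)%N.
Proof.
move=> l0 l1 l2.
have sF k := submod_freepow r k; have sK := submod_fpow.
(* [B a k] modulo [A a k] is the cokernel of l from K_k/m^k in degrees < a to K_(k+1)/m^(k+1) in
   degrees < a + d. *)
pose A a k : {ffun 'I_(a + d) -> free r} -> Prop :=
  sumsub (powmod (freepow k.+1)) (@convmod _ _ d x a) (powmod (N := a) (fpow k)).
pose B a k : {ffun 'I_(a + d) -> free r} -> Prop := powmod (fpow k.+1).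
have sA a k : submod (A a k) by apply: submod_sumsub; apply: submod_pow.
have sB a k : submod (B a k) by apply: submod_pow.
have fpow_mulS k i u : fpow k u -> fpow k.+1 (x i *: u).
  by move=> h; rewrite /fpow linearZ; apply: freepow_mulS.
have AB a k : sub (A a k) (B a k).
  move=> _ [u [v [hu hv ->]]]; case: (sB a k) => _ BD _; apply: BD.
    by move=> i; apply: freepow_fpow.
  by apply: powmod_convmod hv => // i w; apply: fpow_mulS.
(* By McCoy l is injective here, so its image has length a * t. *)
have lenA a k t t' : len (freepow k) (fpow k) t ->
    len (freepow k.+1) (fpow k.+1) t' ->
    exists2 l, len (A a k) (B a k) l & (a * t + l = (a + d) * t')%N.
  move=> lt lt'.
  have lB := @len_pow _ _ (a + d) _ _ _ (sF k.+1) (sK k.+1) lt'.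
  have [|k1 [l [h1 hl <-]]] := len_sub (sA a k) (sB a k) _ (@AB a k) lB.
    by apply: sub_suml; apply: submod_pow.
  exists l => //; congr (_ + _)%N; apply: len_unique h1.
  refine (proj1 (len_iso (f := @convmod Q (free r) d x a) _ _ _ _ _)
    (@len_pow _ _ a _ _ _ (sF k) (sK k) lt)).
  - exact: submod_pow.
  - exact: submod_pow.
  - by move=> v hv i; apply: freepow_fpow.
  - move=> v _; split; last by apply: powmod_convmod => // i w; apply: freepow_mulS.
    apply: (mccoy_convmod (x := x) (A := @freepow r) (B := fun _ _ => True)) => //.
    + by move=> p i w; apply: freepow_mulS.
    + by move=> p w _; apply: freepow_colon.
have h a : ((a + d) * t1 + a * t1 <= a * t0 + (a + d) * t2)%N.
  have [k lk ek] := lenA a n _ _ l0 l1; have [l ll el] := lenA a n.+1 _ _ l1 l2.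
  suff : (k <= l)%N by lia.
  apply: (len_le_succ (x := x) (A := A a) (B := B a)) lk ll => //.
  - move=> p i _ [u [v [hu hv ->]]]; rewrite scalerDr -linearZ.
    exists (x i *: u), (x i *: v); split=> // j; rewrite ffunE.
      exact: freepow_mulS.
    exact: fpow_mulS.
  - by move=> p i v hv j; rewrite ffunE; apply: fpow_mulS.
  - by move=> p v _; apply: conv_colon.
(* If 2 t1 > t0 + t2, then [h] would force a <= d * t2. *)
by have := h (d * t2).+1; nia.
Qed.

Lemma hilbert_mono : exists H : nat -> nat,
  (forall n, quot_length (ideal_smul (ipow m n.+1) : M -> Prop)
                         (ideal_smul (ipow m n)) (H n)) /\
  (forall n, (H n <= H n.+1)%N).
Proof.
have [q hq] := functional_choice _ len_gr.
have [t ht] := functional_choice _ len_fpow.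
have sF k := submod_freepow r k; have sK := submod_fpow.
(* The length of K_n/m^(n+1) Q^r is computed through m^n Q^r and through K_(n+1). *)
have hk n : exists2 k, len (fpow n.+1) (fpow n) k & (t n.+1 + k = r * q n + t n)%N.
  have := @len_pow _ _ r _ _ _ (submod_ipow n.+1) (submod_ipow n) (hq n).
  move/len_add => /(_ _ _ (sF n) (sK n) (ht n)) h.
  have [k [l [lk ll <-]]] := len_sub (sK n.+1) (sK n) (@freepow_fpow n.+1)
    (@fpowS_sub n) h.
  by exists l => //; rewrite (len_unique lk (ht _)).
have hM n : exists l, len (ideal_smul (ipow m n.+1) : M -> Prop) (ideal_smul (ipow m n)) l
    /\ (l + r * q n + t n = s * q n + t n.+1)%N.
  have [k lk ek] := hk n; have [l ll el] := len_hilbert (hq n) lk.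
  by exists l; split=> //; lia.
have [H hH] := functional_choice _ hM.
exists H; split=> n.
  by apply: quot_length_len (hH n).1; apply: submod_ideal_smul.
(* H(n+1) - H(n) equals (s - r)(q(n+1) - q(n)) plus t(n+2) - 2 t(n+1) + t(n), and both terms are
   nonnegative. *)
have := len_fpow_convex (ht n) (ht n.+1) (ht n.+2).
have := len_gr_mono (hq n) (hq n.+1).
have := (hH n).2; have := (hH n.+1).2; rewrite -(subnKC le_rs) !mulnDl; nia.
Qed.
End Presentation.
End LocalRing.

(** * The presentation of a module of projective dimension at most one *)

Section LocalFree.
Variable Q : comUnitRingType.
Local Notation free r := {ffun 'I_r -> Q^o}.
Variable m : Q -> Prop.
Hypothesis loc : local_ring m.

Lemma prod_sub_max (I : finType) (a b : I -> Q) : (forall i, m (a i - b i)) ->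
  m (\prod_i a i - \prod_i b i).
Proof.
have [m0 mD mM] := ideal_max loc.
move=> h; elim/big_rec2: _ => [|i y z _ IH]; first by rewrite subrr.
have -> : a i * z - b i * y = z * (a i - b i) + b i * (z - y) by ring.
by apply: mD; apply: mM.
Qed.

(** The matrix of [e] is the identity modulo m, so its determinant is 1 modulo m, hence a unit. *)
Lemma injective_mod_max r (e : {linear free r -> free r}) u :
  (forall v i, m ((e v - v) i)) -> e u = 0 -> u = 0.
Proof.
move=> h eu0; have [m0 mD mM] := ideal_max loc.
pose A : 'M[Q]_r := \matrix_(i, j) e (inj_at i (1 : Q^o)) j.
have uA : A \in unitmx.
  rewrite unitmxE; have [_ _ m1] := loc; apply=> mdet; apply: m1.
  have -> : 1 = - (\det A - \det (1%:M : 'M[Q]_r)) + \det A by rewrite det1; ring.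
  apply: (mD) => //; rewrite -mulN1r; apply: (mM); rewrite /determinant -sumrB.
  apply: (big_ind m m0 mD) => s _; rewrite -mulrBr; apply: mM.
  apply: prod_sub_max => i; have := h (inj_at i (1 : Q^o)) (s i).
  by rewrite !mxE !ffunE eq_sym; case: eqP.
have : (\row_i u i) *m A = 0.
  apply/rowP=> j; rewrite !mxE; transitivity (e u j); last by rewrite eu0 ffunE.
  rewrite free_linear /lincomb sum_ffunE.
  by apply: eq_bigr => i _; rewrite !mxE ffunE.
move/(congr1 (mulmx^~ (invmx A))); rewrite mulmxK // mul0mx => /rowP u0.
by apply/ffunP=> i; have := u0 i; rewrite !mxE ffunE.
Qed.

(** A relation with a coefficient outside m can be solved for that generator, which is then
    dropped. *)
Lemma minimal_generators (W : lmodType Q) (N : W -> Prop) k (g : 'I_k -> W) :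
  generates N g -> exists k' (g' : 'I_k' -> W), generates N g' /\
    forall c, lincomb g' c = 0 -> forall i, m (c i).
Proof.
elim: k g => [|k IH] g Ng; first by exists 0%N, g; split=> // c _ [[]].
have [|] := classic (forall c, lincomb g c = 0 -> forall i, m (c i)).
  by exists k.+1, g; split.
move=> /not_all_ex_not [c nc]; have [c0 nci'] := imply_to_and _ _ nc.
have [i nci] := not_all_ex_not _ _ nci'.
apply: (IH (g \o lift i)); have [gN hg] := Ng; split=> [j|w /hg[b ->]]; first exact: gN.
have uci : c i \is a GRing.unit by case: loc => _ _ _; apply.
exists [ffun j => b (lift i j) - b i * (c i)^-1 * c (lift i j)].
rewrite /lincomb in c0 *; rewrite !(bigD1_ord i) //= in c0 *.
have /eqP : (c i)^-1 *: (c i *: g i + \sum_(j < k) c (lift i j) *: g (lift i j)) = 0.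
  by rewrite c0 scaler0.
rewrite scalerDr scalerA mulVr // scale1r addr_eq0 => /eqP ->.
rewrite scalerN scalerA scaler_sumr addrC -sumrB; apply: eq_bigr => j _.
by rewrite ffunE scalerBl scalerA.
Qed.

(** Minimal generators of ker pi define [q]. Comparing it with the projective resolution in both
    directions yields an endomorphism of Q^r that kills ker q and is the identity modulo m, so [q]
    is injective. *)
Lemma free_presentation (M : lmodType Q) : finite_mod M -> projdim_le1 M ->
  exists r s (phi : {linear free r -> free s}) (pi : {linear free s -> M}),
  [/\ forall v, exists w, pi w = v, forall w, pi w = 0 <-> exists u, w = phi u
    & injective phi].
Proof.
move=> [gs hgs] [P0 [P1 [i [p [proj0 proj1 inj_i surj_p exact_p]]]]].
pose s := size gs; pose pi : {linear free s -> M} := lincomb (fun k : 'I_s => gs`_k).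
have surj_pi v : exists w, pi w = v.
  have [c ->] := hgs v; exists [ffun k => c k].
  by apply: eq_bigr => k _; rewrite ffunE.
have [] := @noetherian_free Q s (fun w => pi w = 0).
- by case: loc.
- split=> [|v w|a w]; rewrite ?linear0 // ?linearD ?linearZ /=.
    by move=> -> ->; rewrite addr0.
  by move=> ->; rewrite scaler0.
move=> k0 [g0 /minimal_generators[r [g [[gN hg] gmin]]]].
pose q : {linear free r -> free s} := lincomb g.
have pi_q u : pi (q u) = 0.
  by rewrite linear_sum big1 // => j _; rewrite linearZ gN /= scaler0.
have q_ker w : pi w = 0 -> exists u, q u = w by move=> /hg[c ->]; exists c.
exists r, s, q, pi; split=> // [w|].
  by split=> [/q_ker[u <-]|[u ->]]; [exists u|].
have [alpha halpha] : exists al : {linear free s -> P0}, forall w, p (al w) = pi w.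
  by apply: free_lift => w; apply: surj_p.
have [beta hbeta] := proj0 _ _ pi p surj_pi.
(* [alpha] and [beta] lie over M, so id - beta alpha takes values in the kernel of [pi]. *)
have [delta hdelta] : exists de : {linear free s -> free r},
    forall w, q (de w) = (idfun \- (beta \o alpha)) w.
  by apply: free_lift => w; apply: q_ker; rewrite /= linearB hbeta halpha subrr.
have [theta htheta] : exists th : {linear free r -> P1}, forall u, i (th u) = (alpha \o q) u.
  apply: free_lift => u; have /exact_p[y e] : p (alpha (q u)) = 0 by rewrite halpha pi_q.
  by exists y.
have [gamma hgamma] : exists ga : {linear P1 -> free r}, forall y, q (ga y) = (beta \o i) y.
  apply: (projective_lift_kernel (f := pi)) => // y.
  by rewrite /= hbeta; apply/exact_p; exists y.
(* e lifts the identity of ker pi, so it is the identity modulo ker q and hence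
   modulo m; it vanishes on ker q. *)
pose e : {linear free r -> free r} := (delta \o q) \+ (gamma \o theta).
have qe u : q (e u) = q u.
  by rewrite /e /= linearD hdelta hgamma /= htheta /= subrK.
have e_ker u : q u = 0 -> e u = 0.
  move=> qu0; rewrite /e /= qu0 linear0 add0r.
  have -> : theta u = 0 by apply: inj_i; rewrite htheta /= qu0 !linear0.
  by rewrite linear0.
move=> u v quv; apply/eqP; rewrite -subr_eq0; apply/eqP.
apply: (injective_mod_max (e := e)).
  by move=> w j; apply: gmin; rewrite -[lincomb g]/(q : _ -> _) linearB qe subrr.
by apply: e_ker; rewrite linearB quv subrr.
Qed.
End LocalFree.

Theorem theorem3p3 (Q : comUnitRingType) (m : Q -> Prop) (M : lmodType Q) :
  local_ring m -> depth_gr_ge2 m -> finite_mod M -> projdim_le1 M ->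
  exists H : nat -> nat,
    (forall n, quot_length (ideal_smul (ipow m n.+1) : M -> Prop)
                           (ideal_smul (ipow m n)) (H n)) /\
    (forall n, (H n <= H n.+1)%N).
Proof.
move=> loc [X [Y [X0 Y0 reg]]] fin pd.
have [noeth idm _ _] := loc; have [xs gen] := noeth m idm.
have [r [s [phi [pi [surj ker inj]]]]] := free_presentation loc fin pd.
have colon := @ipow_colon Q m loc _ (fun i => xs`_i) gen X Y X0 reg.
have koszul := @ipow_koszul Q m loc _ (fun i => xs`_i) gen X Y X0 Y0 reg.
exact: (hilbert_mono loc gen colon koszul surj ker (rank_le_of_injective inj)).
Qed.
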